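(* There are uncountably many orbits of the standard tent map $T$ without mass center; that is, the set of (forward) orbits $\{T^i(x): i\ge 0\}$, over those $x\in[0,1]$ for which the sequence $\frac{1}{n}\sum_{i=0}^{n-1}T^i(x)$ does not converge as $n\to\infty$, is uncountable.
   Context: The standard tent map is $T:[0,1]\to[0,1]$, $T(x)=1-|2x-1|$, i.e. $T(x)=2x$ for $x\in[0,\frac12]$ and $T(x)=2(1-x)$ for $x\in[\frac12,1]$. The orbit of $x\in[0,1]$ is its forward orbit under $T$. If the partial time averages $\frac{1}{n}\sum_{i=0}^{n-1}T^i(x)$ converge as $n\to\infty$, the limit is called the center of mass (mass center) of the orbit of $x$; otherwise the orbit of $x$ has no mass center. *)

(* Defs.v *)
From HB Require Import structures.
From mathcomp Require Import all_boot all_order all_algebra.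
From mathcomp Require Import all_classical all_reals all_analysis.
Import Order.TTheory GRing.Theory Num.Theory.
Import numFieldNormedType.Exports.

Set Implicit Arguments.
Unset Strict Implicit.
Unset Printing Implicit Defensive.

Local Open Scope classical_set_scope.
Local Open Scope ring_scope.

(* The formula makes sense on all of R; the map is only meant to be iterated
   on the invariant interval [0, 1]. *)
Definition tent {R : realType} (x : R) : R := 1 - `|2 * x - 1|.

Definition forward_orbit {X : Type} (f : X -> X) (x : X) : set X :=
  [set iter i f x | i in [set: nat]].

(* The library's arithmetic_mean is indexed from 0: its term of rank n is
   (n + 1)^-1 * \sum_(0 <= i < n + 1) f^i(x), i.e. the average of the first
   n + 1 points, so the undefined average of no points does not occur. *)
Definition time_averages {R : realType} (f : R -> R) (x : R) : R^nat :=
  arithmetic_mean (fun i => iter i f x).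

Definition has_mass_center {R : realType} (f : R -> R) (x : R) : Prop :=
  cvgn (time_averages f x).

(* Main.v *)
Require Import Defs.
From HB Require Import structures.
From mathcomp Require Import all_boot all_order all_algebra.
From mathcomp Require Import all_classical all_reals all_analysis.
From mathcomp Require Import lra.
Import Order.TTheory GRing.Theory Num.Theory.
Import numFieldNormedType.Exports.
Local Open Scope classical_set_scope.
Local Open Scope ring_scope.

(** A Baire category argument on the real line.  Write A_n for the average of
    the first n + 1 points of an orbit.  The branches of the tent map T have
    slope 2 in absolute value and each maps onto [0, 1], so for any a in
    [0, 1] the points that some iterate of T sends to a are dense in [0, 1]
    ([tent_preimage_near]).  Take for a one of the two fixed points 0 and 2/3:
    the orbit of such a point is eventually constant equal to a, so that its
    averages A_n tend to a.  Hence, for each n, the set of points of [0, 1]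
    having an average A_k with k >= n within 1/4 of a is dense in [0, 1], and
    it is relatively open because A_k is continuous.

    By Baire's theorem, a generic point of [0, 1] has averages within 1/4 of 0
    infinitely often and also within 1/4 of 2/3 infinitely often.  A limit of
    the averages would be within 1/4 of both 0 and 2/3, which is impossible
    since 1/4 + 1/4 < 2/3; so a generic point has no mass center.  Removing
    countably many points from a dense countable intersection of open dense
    sets leaves it dense ([dense_bigcapD_countable]), so the points without
    mass center cannot be countably many.  As an orbit is a countable set
    containing its starting point, their orbits cannot be countably many
    either ([countable_from_countable_orbits]). *)

Lemma tent_itv01 (R : realType) (x : R) : 0 <= x <= 1 -> 0 <= tent x <= 1.
Proof.
by rewrite /tent; case: (ger0P (2 * x - 1)) => h /andP[x0 x1];
  apply/andP; split; lra.
Qed.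

Lemma continuous_tent (R : realType) : continuous (@tent R).
Proof.
move=> x; rewrite /tent.
apply: cvgB; first exact: cvg_cst.
apply: cvg_norm; apply: cvgB; last exact: cvg_cst.
by apply: cvgM; [exact: cvg_cst|exact: cvg_id].
Qed.

(** Pulling a back along the orbit of x, by the inverse branch whose image
    contains the current point, halves the distance to that orbit at each
    step; at the start of the pull-back this distance is at most 1. *)
Lemma tent_preimage_near (R : realType) (m : nat) (x a : R) :
  0 <= x <= 1 -> 0 <= a <= 1 ->
  exists y : R, [/\ 0 <= y <= 1, `|y - x| <= 2^-1 ^+ m & iter m tent y = a].
Proof.
move=> x01 a01; elim: m => [|m IHm] in x x01 *.
  exists a; split=> //; rewrite expr0 ler_norml.
  by move/andP: x01 => [? ?]; move/andP: a01 => [? ?]; apply/andP; split; lra.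
have [z [/andP[z0 z1] zx za]] := IHm _ (tent_itv01 _ _ x01).
move: zx; rewrite ler_norml exprS => /andP[]; set e := 2^-1 ^+ m.
(* The inverse branch that is followed is the one whose image contains x. *)
pose y : R := if 2 * x <= 1 then z / 2 else 1 - z / 2.
have Ty : tent y = z.
  rewrite /tent /y; case: ifP => _.
    by rewrite ler0_norm; lra.
  by rewrite ger0_norm; lra.
have y01 : 0 <= y <= 1 by rewrite /y; case: ifP => _; apply/andP; split; lra.
rewrite {1 2}/tent => zx1 zx2; exists y; split=> //; last by rewrite iterSr Ty.
move: zx1 zx2; rewrite ler_norml /y.
by case: (lerP (2 * x) 1) => _ ? ?; apply/andP; split; lra.
Qed.

(** The orbit is constant from rank m on, so Cesaro's theorem applies. *)
Lemma time_averages_cvg_fixpoint (R : realType) (f : R -> R) (m : nat) (x a : R) :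
  f a = a -> iter m f x = a -> time_averages f x @ \oo --> a.
Proof.
move=> fa xa; apply: cesaro; apply: cvg_near_cst.
exists m => // n /= mn; rewrite -(subnK mn) iterD xa.
by elim: (n - m)%N => //= k ->.
Qed.

Lemma continuous_time_averages (R : realType) (f : R -> R) (n : nat) :
  continuous f -> continuous (time_averages f ^~ n).
Proof.
move=> cf x.
have citer i : continuous (iter i f).
  elim: i => [|i IHi] y; first exact: cvg_id.
  exact: (continuous_comp (IHi y) (cf _)).
rewrite /time_averages /arithmetic_mean /series /=.
apply: cvgM; first exact: cvg_cst.
by apply: cvg_big => [y|i _]; [exact: add_continuous|exact: citer].
Qed.

(** The radius 1/4 only has to be less than half the distance between the two
    fixed points 0 and 2/3 of the tent map. *)
Definition averages_return {R : realType} (f : R -> R) (a : R) (n : nat) : set R :=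
  [set x | exists2 k, (n <= k)%N & `|time_averages f x k - a| < 4^-1].

Lemma open_averages_return (R : realType) (f : R -> R) (a : R) (n : nat) :
  continuous f -> open (averages_return f a n).
Proof.
move=> cf.
have -> : averages_return f a n =
    \bigcup_(k in [set k | (n <= k)%N])
      ((fun x => `|time_averages f x k - a|) @^-1` [set t : R | t < 4^-1]).
  by apply/seteqP; split=> x [k nk xk]; exists k.
apply: bigcup_open => k _; apply: open_comp; last exact: open_lt.
move=> x _; apply: cvg_norm; apply: cvgB; last exact: cvg_cst.
exact: continuous_time_averages.
Qed.

Lemma averages_return_limit (R : realType) (f : R -> R) (a l x : R) :
  (forall n, averages_return f a n x) -> time_averages f x @ \oo --> l ->
  `|l - a| <= 4^-1.
Proof.
move=> ret xl; rewrite leNgt; apply/negP => la.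
have : (fun n => `|time_averages f x n - a|) @ \oo --> `|l - a|.
  by apply: cvg_norm; apply: cvgB => //; exact: cvg_cst.
move=> /(cvgr_gt _) /(_ _ la) [N _ farN].
have [k /farN + /ltW] := ret N.
by rewrite /= ltNge => /negP.
Qed.

(** Adding the complement of [0, 1], where tent orbits escape to -oo, turns
    sets that are open and dense relatively to [0, 1] into open dense subsets
    of the line, which is the complete space in which Baire's theorem is
    used. *)
Definition tent_return {R : realType} (a : R) (n : nat) : set R :=
  averages_return tent a n `|` ~` `[0, 1].

Lemma open_tent_return (R : realType) (a : R) (n : nat) : open (tent_return a n).
Proof.
apply: openU; first exact: open_averages_return (@continuous_tent R).
by rewrite openC; exact: itv_closed.
Qed.

Lemma dense_tent_return (R : realType) (a : R) (n : nat) :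
  0 <= a <= 1 -> tent a = a -> dense (tent_return a n).
Proof.
move=> a01 Ta O [x Ox] oO.
have [x01|x01] := pselect (`[0, 1]%classic x); last by exists x; split => //; right.
move: (oO); rewrite openE => /(_ _ Ox) /nbhs_ballP [e /= e0 eO].
have [m me] : exists m, (2^-1 : R) ^+ m < e.
  have /cvgr_lt /(_ _ e0) [m _ /(_ m (leqnn m)) me] :
    (fun m => (2^-1 : R) ^+ m) @ \oo --> (0 : R).
    by apply: cvg_expr; rewrite gtr0_norm; lra.
  by exists m.
have [|y [y01 yx ya]] := @tent_preimage_near R m x a _ a01.
  by move: x01; rewrite /= in_itv.
exists y; split.
  by apply: eO; rewrite /ball /= distrC; exact: le_lt_trans yx me.
left; have /cvgrPdist_lt := time_averages_cvg_fixpoint _ _ _ _ _ Ta ya.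
move=> /(_ 4^-1) [|k _ near_a]; first lra.
exists (maxn n k); first exact: leq_maxl.
by rewrite distrC; apply: near_a; exact: leq_maxr.
Qed.

(** Each point of the countable set costs one more open dense set, its
    complement, in Baire's theorem. *)
Lemma dense_bigcapD_countable (R : realType) (F : (set R)^nat) (A : set R) :
  (forall n, open (F n) /\ dense (F n)) -> countable A ->
  dense (\bigcap_n F n `\` A).
Proof.
move=> Fod /countable_injP [g ginj].
(* e enumerates A; its default value 0, at the ranks that g does not take on
   A, can only remove the point 0 as well. *)
pose e n := xget 0 [set x | A x /\ g x = n].
have : dense (\bigcap_n (~` [set e n] `&` F n)).
  apply: Baire => n; have [oF dF] := Fod n.
  have oe : open (~` [set e n]) by rewrite openC; exact: closed_eq.
  split; first exact: openI.
  by apply: denseI => //; exact: dense_set1C.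
move=> dG O O0 oO; have [x [Ox Gx]] := dG O O0 oO.
exists x; split=> //; split=> [n _|Ax]; first by have [] := Gx n I.
have [xe _] := Gx (g x) I; apply: xe => /=.
have [Ae ge] : A (e (g x)) /\ g (e (g x)) = g x.
  by apply: (@xgetPex _ 0 [set z | A z /\ g z = g x]); exists x.
by apply: ginj; rewrite ?inE.
Qed.

(** A is covered by the orbits of its points, and each orbit is countable. *)
Lemma countable_from_countable_orbits (X : Type) (f : X -> X) (A : set X) :
  countable [set forward_orbit f x | x in A] -> countable A.
Proof.
move=> /(bigcup_countable (F := id)) cA; apply: (sub_countable _ (cA _)).
  apply: subset_card_le => x Ax; exists (forward_orbit f x); first by exists x.
  by exists 0%N.
by move=> _ [x _ <-]; apply: (sub_countable (card_image_le _ _)); exact: countableP.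
Qed.

Theorem theorem2 (R : realType) :
  ~ countable [set forward_orbit (@tent R) x |
                 x in [set x : R | 0 <= x <= 1 /\ ~ has_mass_center (@tent R) x]].
Proof.
move=> /countable_from_countable_orbits cN.
have ret0 n : dense (@tent_return R 0 n).
  apply: dense_tent_return; first by rewrite lexx ler01.
  by rewrite /tent ler0_norm; lra.
have ret23 n : dense (@tent_return R (2 / 3) n).
  apply: dense_tent_return; first by apply/andP; split; lra.
  by rewrite /tent ger0_norm; lra.
have [|||x [x01 [Fx Nx]]] := @dense_bigcapD_countable R
    (fun n => tent_return 0 n `&` tent_return (2 / 3) n) _ _ cN `]0, 1[%classic.
- by move=> n; split; [apply: openI|apply: denseI] => //; exact: open_tent_return.
- by exists 2^-1 => /=; rewrite in_itv /=; apply/andP; split; lra.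
- exact: itv_open.
have x01c : 0 <= x <= 1 by move: x01; rewrite /= in_itv /= => /andP[/ltW-> /ltW->].
have retx a : (forall n, tent_return a n x) -> forall n, averages_return tent a n x.
  by move=> r n; case: (r n) => // -[]; rewrite /= in_itv.
apply: Nx; split=> // /cvg_ex[l xl].
have := averages_return_limit _ _ 0 _ _ (retx _ (fun n => (Fx n I).1)) xl.
have := averages_return_limit _ _ (2 / 3) _ _ (retx _ (fun n => (Fx n I).2)) xl.
by rewrite !ler_norml => /andP[? ?] /andP[? ?]; lra.
Qed.
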